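(* Let $A \in \mathcal M_d(\mathbb R)$, let $I \subset \mathbb R_+^\ast$ be a compact interval, $\tau_{\min} = \inf I > 0$, $\tau_{\max} = \sup I < +\infty$, and let $\tau\colon \mathbb R_+ \times \mathsf L \to I$ be a function, where $\mathsf L = C([-\tau_{\max}, 0], \mathbb R^d)$ (respectively, $\mathsf L = G([-\tau_{\max}, 0], \mathbb R^d)$). If $\rho(A) < 1$, then there exist positive constants $C$ and $\gamma$ such that, for every continuous (respectively, regulated) solution $x$ of $$x(t) = A x(t - \tau(t, x_t)), \qquad t \geq 0,$$ denoting by $x_0$ its initial condition, we have $$\lVert x_t\rVert_{\mathsf L} \leq C e^{-\gamma t} \lVert x_0\rVert_{\mathsf L} \qquad \text{for every } t \in \mathbb R_+.$$
   Context: $\mathbb R_+ = [0, +\infty)$, $\mathbb R_+^\ast = (0, +\infty)$; $\mathcal M_d(\mathbb R)$ is the set of real $d \times d$ matrices, $d$ a positive integer, $\rho(A)$ is the spectral radius of $A$, and $\lvert\cdot\rvert$ is a norm on $\mathbb R^d$. The interval $I$ is nonempty. For a nonempty closed interval $K \subset \mathbb R$ (possibly unbounded), a function $f\colon K \to \mathbb R^d$ is \emph{regulated} if it has (finite) right limits at every point of $K$ other than its right endpoint and (finite) left limits at every point of $K$ other than its left endpoint; $G(K, \mathbb R^d)$ is the set of such functions. In both cases the norm on $\mathsf L$ is $\lVert y\rVert_{\mathsf L} = \sup_{s \in [-\tau_{\max}, 0]} \lvert y(s)\rvert$. A continuous (respectively, regulated) solution of the state-dependent equation is a continuous (respectively,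 regulated) function $x\colon [-\tau_{\max}, +\infty) \to \mathbb R^d$ such that $x(t) = A x(t - \tau(t, x_t))$ for every $t \in \mathbb R_+$, where $x_t \in \mathsf L$ is given by $x_t(s) = x(t + s)$ for $s \in [-\tau_{\max}, 0]$; its initial condition is $x_0 = x\rvert_{[-\tau_{\max}, 0]}$. *)

(* Defs.v *)
From HB Require Import structures.
From mathcomp Require Import all_boot all_order all_algebra.
From mathcomp Require Import complex.
From mathcomp Require Import all_classical all_reals all_analysis.

Set Implicit Arguments.
Unset Strict Implicit.
Unset Printing Implicit Defensive.

Import Order.TTheory GRing.Theory Num.Theory.
Import numFieldNormedType.Exports.

Local Open Scope classical_set_scope.
Local Open Scope ring_scope.

Definition spectral_radius (R : realType) (d : nat) (A : 'M[R]_d) : R :=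
  sup [set ComplexField.Normc.normc l | l in
    [set l : R[i] | eigenvalue (map_mx (real_complex R) A) l]].

Record is_norm (R : realType) (V : lmodType R) (N : V -> R) : Prop := IsNorm {
  is_norm_ge0 : forall v, 0 <= N v;
  is_norm_eq0 : forall v, N v = 0 -> v = 0;
  is_normZ : forall (a : R) v, N (a *: v) = `|a| * N v;
  is_norm_triangle : forall v w, N (v + w) <= N v + N w }.

(* A function K -> R^d on a subset K of R is represented by a total function
   R -> R^d whose values outside K are irrelevant.  Limits and continuity in
   'cV[R]_d refer to its canonical topology, which is that of every norm. *)

(* For an interval K, a point t of K is not the right (resp. left) endpoint of
   K iff K has an element > t (resp. < t); the one-sided filters t^'+ and t^'-
   then only see points of K. *)
Definition regulated (R : realType) (d : nat) (K : set R)
    (f : R -> 'cV[R]_d) : Prop :=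
  (forall t, K t -> (exists2 u, K u & t < u) ->
     exists l : 'cV[R]_d, f s @[s --> t^'+] --> l) /\
  (forall t, K t -> (exists2 u, K u & u < t) ->
     exists l : 'cV[R]_d, f s @[s --> t^'-] --> l).

Inductive regularity := ContinuousClass | RegulatedClass.

(* C(K, R^d), respectively G(K, R^d). *)
Definition has_regularity (r : regularity) (R : realType) (d : nat)
    (K : set R) (f : R -> 'cV[R]_d) : Prop :=
  match r with
  | ContinuousClass => {within K, continuous f}
  | RegulatedClass => regulated K f
  end.

Definition in_phase_space (r : regularity) (R : realType) (d : nat) (T : R)
    (y : R -> 'cV[R]_d) : Prop :=
  has_regularity r `[- T, 0] y.

Definition phase_norm (R : realType) (d : nat) (N : 'cV[R]_d -> R) (T : R)
    (y : R -> 'cV[R]_d) : R :=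
  sup [set N (y s) | s in `[- T, 0]].

Definition history (R : realType) (d : nat) (x : R -> 'cV[R]_d) (t : R) :
    R -> 'cV[R]_d :=
  fun s => x (t + s).

(* tau is a function from R_+ x L to I, where L is the phase space over
   [- T, 0]: elements of L being represented by total functions, the second
   conjunct expresses that tau t y depends only on y restricted to [- T, 0]. *)
Definition is_delay (r : regularity) (R : realType) (d : nat) (T : R)
    (I : set R) (tau : R -> (R -> 'cV[R]_d) -> R) : Prop :=
  (forall (t : R) y, 0 <= t -> in_phase_space r T y -> I (tau t y)) /\
  (forall (t : R) y z, 0 <= t -> in_phase_space r T y -> in_phase_space r T z ->
     (forall s : R, - T <= s <= 0 -> y s = z s) -> tau t y = tau t z).

Definition is_solution (r : regularity) (R : realType) (d : nat) (T : R)
    (A : 'M[R]_d) (tau : R -> (R -> 'cV[R]_d) -> R)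
    (x : R -> 'cV[R]_d) : Prop :=
  has_regularity r `[- T, +oo[ x /\
  (forall t : R, 0 <= t -> x t = A *m x (t - tau t (history x t))).

(* Main.v *)
(* Iterating t |-> t - tau(t, x_t) from t >= 0, each step being at least
   min I > 0, reaches [- sup I, 0] after finitely many, say k, steps, so
   x(t) = A^k x(s) with s in [- sup I, 0] and k >= t / sup I.  Exponential
   decay thus reduces to |A^k| <= C q^k for some q < 1.  The latter is obtained
   without Jordan forms: by Cayley-Hamilton the product of the A - a, over the
   complex eigenvalues a, vanishes, and the factors are removed one by
   one: for |a| < q, if u_(k+1) - a u_k = O(q^k) then u_k = O(q^k).
   Boundedness of x on [- sup I, 0] is needed for the supremum defining |x_0|
   to be an upper bound (sup is 0 on unbounded sets). *)

Require Import Defs.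
From mathcomp Require Import all_boot all_order all_algebra.
From mathcomp Require Import complex ring lra.
From mathcomp Require Import all_classical all_reals all_analysis.
Import Order.TTheory GRing.Theory Num.Theory.
Import numFieldNormedType.Exports.
Import ComplexField.Normc.
Local Open Scope classical_set_scope.
Local Open Scope ring_scope.

Set Implicit Arguments.
Unset Strict Implicit.

(** * Geometric decay of the powers of a matrix *)

Lemma geometric_domination (R : realFieldType) (a q C : R) (u : nat -> R) :
  0 <= a -> a < q -> 0 <= C ->
  (forall k, u k.+1 <= a * u k + C * q ^+ k) ->
  exists C', 0 <= C' /\ forall k, u k <= C' * q ^+ k.
Proof.
move=> a0 aq C0 hu; have qa : 0 < q - a by rewrite subr_gt0.
(* The first argument handles k = 0. The second gives a D + C <= q D, which closes the induction. *)
exists (Num.max `|u 0%N| (C / (q - a))); split.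
  by rewrite le_max normr_ge0.
set D := Num.max _ _.
have CD : C <= D * (q - a) by rewrite -ler_pdivrMr// le_max lexx orbT.
elim=> [|k ih].
  by rewrite expr0 mulr1 le_max ler_norm.
have qk : 0 <= q ^+ k by rewrite exprn_ge0// ltW// (le_lt_trans a0).
rewrite exprS (le_trans (hu k))//.
have := ler_wpM2l a0 ih; have := ler_wpM2r qk CD.
nra.
Qed.

(** [B] is arbitrary so that, in the induction on [s], each removed factor [A - a] can be absorbed
    into it: the hypothesis for [(A - a) * B] bounds the difference of [A ^+ k.+1 * B] and
    [a *: (A ^+ k * B)]. *)
Lemma power_entry_bound (R : realType) (n : nat) (A : 'M[R[i]]_n.+1) (q : R)
    (s : seq R[i]) (i j : 'I_n.+1) :
  0 <= q -> (forall a, a \in s -> normc a < q) ->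
  forall B : 'M[R[i]]_n.+1,
  horner_mx A (\prod_(a <- s) ('X - a%:P)) * B = 0 ->
  exists C, 0 <= C /\ forall k, normc ((A ^+ k * B) i j) <= C * q ^+ k.
Proof.
move=> q0; elim: s => [|a s ih] sq B.
  rewrite big_nil rmorph1 mul1r => ->; exists 0; split=> // k.
  by rewrite mulr0 mxE normc0 mul0r.
rewrite big_cons mulrC rmorphM -mulrA => /ih[|C [C0 CB]].
  by move=> b bs; rewrite sq// inE bs orbT.
have := @geometric_domination R (normc a) q C
  (fun k => normc ((A ^+ k * B) i j)).
apply=> //; first by case: (a) => x y; rewrite /normc sqrtr_ge0.
  by rewrite sq// inE eqxx.
move=> k; rewrite -normcM; apply: le_trans (lerD (lexx _) (CB k)).
apply: le_trans (le_normcD _ _).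
rewrite le_eqVlt; apply/orP; left; apply/eqP; congr normc.
have -> : A ^+ k * (horner_mx A ('X - a%:P) * B) =
         A ^+ k.+1 * B - a *: (A ^+ k * B).
  rewrite rmorphB/= horner_mx_X horner_mx_C mulrBl mulrBr mulrA -exprSr.
  by congr (_ - _); rewrite -!mulmxE mul_scalar_mx -scalemxAr.
by rewrite !mxE; ring.
Qed.

Lemma spectral_radius_power_bound (R : realType) (n : nat) (A : 'M[R]_n.+1) :
  spectral_radius A < 1 ->
  exists q C, [/\ 0 < q < 1, 0 <= C &
    forall k i j, `|(A ^+ k) i j| <= C * q ^+ k].
Proof.
move=> rA; set Ac := map_mx (real_complex R) A.
have [s Es] := closed_field_poly_normal (char_poly Ac).
rewrite (monicP (char_poly_monic Ac)) scale1r in Es.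
have sP a : a \in s -> normc a <= spectral_radius A.
  move=> as_; apply: ub_le_sup; last first.
    by exists a => //=; rewrite eigenvalue_root_char Es root_prod_XsubC.
  (* The supremum bounds the moduli only if they are bounded above; the sum over all roots is such a
     bound. *)
  exists (\sum_(b <- s) normc b) => _ /= [b + <-].
  rewrite eigenvalue_root_char Es root_prod_XsubC => bs.
  rewrite (big_rem b)//= lerDl sumr_ge0// => -[x y] _.
  by rewrite /normc sqrtr_ge0.
pose m := Num.max 0 (spectral_radius A).
have m0 : 0 <= m by rewrite le_max lexx.
have m1 : m < 1 by rewrite gt_max ltr01.
(* The midpoint of [m] and 1 lies strictly above every modulus, and is positive since [m] is at
   least 0. *)
pose q := (1 + m) / 2.
have q0 : 0 < q by rewrite /q; lra.
have mq : m < q by rewrite /q; lra.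
have CH : horner_mx Ac (\prod_(a <- s) ('X - a%:P)) * 1 = 0.
  by rewrite -Es mulr1 Cayley_Hamilton.
have sq a : a \in s -> normc a < q.
  by move=> /sP h; rewrite (le_lt_trans _ mq)// le_max h orbT.
have H i j := @power_entry_bound R n Ac q s i j (ltW q0) sq 1 CH.
pose Cf i j := projT1 (cid (H i j)).
have CfP i j := projT2 (cid (H i j)).
exists q, (\sum_i \sum_j Cf i j); split.
- by rewrite q0 /q /=; lra.
- by rewrite !sumr_ge0// => i _; rewrite sumr_ge0// => j _; case: (CfP i j).
move=> k i j; have [_ /(_ k)] := CfP i j.
rewrite mulr1 /Ac -rmorphXn/= mxE /normc/= expr0n/= addr0 sqrtr_sqr.
move=> /le_trans; apply; apply: ler_wpM2r; first by rewrite exprn_ge0// ltW.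
rewrite (bigD1 i)//= (bigD1 j)//= -addrA lerDl addr_ge0 ?sumr_ge0//.
  by move=> j' _; case: (CfP i j').
by move=> i' _; rewrite sumr_ge0// => j' _; case: (CfP i' j').
Qed.

(** * Equivalence of an arbitrary norm with the maximum norm *)

Lemma mx_entry_le_norm (R : realType) (m n : nat) (M : 'M[R]_(m, n)) i j :
  `|M i j| <= `|M|.
Proof.
rewrite [leRHS]mx_normrE.
exact: (le_bigmax _ (fun p => `|M p.1 p.2|) (i, j)).
Qed.

Lemma mx_norm_le (R : realType) (m n : nat) (M : 'M[R]_(m, n)) (c : R) :
  0 <= c -> (forall i j, `|M i j| <= c) -> `|M| <= c.
Proof.
move=> c0 Mc; rewrite [leLHS]mx_normrE; apply/bigmax_leP.
by split=> // -[i j] _ /=.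
Qed.

Lemma norm_le_mx_norm (R : realType) (d : nat) (N : 'cV[R]_d -> R) :
  is_norm N -> exists c, 0 <= c /\ forall v, N v <= c * `|v|.
Proof.
move=> hN.
have N0 : N 0 = 0 by rewrite -(scale0r 0) (is_normZ hN) normr0 mul0r.
exists (\sum_i N (delta_mx i 0)); split.
  by rewrite sumr_ge0// => i _; exact: is_norm_ge0.
move=> v; rewrite {1}(matrix_sum_delta v).
under eq_bigr do rewrite big_ord1.
rewrite mulr_suml; elim/big_ind2 : _ => [|x1 x2 y1 y2 h1 h2|i _].
- by rewrite N0.
- by apply: le_trans (is_norm_triangle hN _ _) _; exact: lerD.
by rewrite (is_normZ hN) mulrC ler_wpM2l// ?is_norm_ge0// mx_entry_le_norm.
Qed.

(** The norm [N] is Lipschitz for the maximum norm, so it attains a positive minimum on the compact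
    unit sphere; homogeneity extends the bound to all vectors. Transposition moves the argument to
    row vectors, where the extreme value theorem is applied. *)
Lemma mx_norm_le_norm (R : realType) (d : nat) (N : 'cV[R]_d.+1 -> R) :
  is_norm N -> exists c, 0 <= c /\ forall v, `|v| <= c * N v.
Proof.
move=> hN; have [c [c0 Nc]] := norm_le_mx_norm hN.
have Ntr (v : 'rV_d.+1) : N v^T <= c * `|v|.
  apply: le_trans (Nc _) _; apply: ler_wpM2l => //.
  by apply: mx_norm_le => // i j; rewrite mxE mx_entry_le_norm.
pose f (v : 'rV[R]_d.+1) := N v^T.
pose S := [set v : 'rV[R]_d.+1 | `|v| = 1].
have NN (v : 'cV_d.+1) : N (- v) = N v.
  by rewrite -scaleN1r (is_normZ hN) normrN1 mul1r.
have Sf v w : f v - f w <= c * `|v - w|.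
  rewrite lerBlDr; apply: le_trans (lerD (Ntr (v - w)) (lexx _)).
  by rewrite -{1}(subrK w v) /f [X in N X]linearD /= is_norm_triangle.
have cf : continuous f.
  move=> v; apply/(@cvgrPdist_le _ _ _ (nbhs v)) => e e0.
  have c1 : 0 < c + 1 by rewrite ltr_wpDl.
  apply/nbhs_ballP; exists (e / (c + 1)); first exact: divr_gt0.
  move=> w; rewrite -ball_normE /= => /ltW; rewrite ler_pdivlMr// => h.
  have := Sf v w; have := Sf w v; rewrite (distrC w v).
  have := normr_ge0 (v - w) => h0 h1 h2.
  by rewrite ler_norml; apply/andP; split; nra.
have S0 : S !=set0.
  exists (const_mx 1); rewrite /S /=; apply/eqP.
  rewrite eq_le; apply/andP; split.
    by apply: mx_norm_le => // i j; rewrite mxE normr1.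
  by have := mx_entry_le_norm (const_mx 1 : 'rV[R]_d.+1) 0 0; rewrite mxE normr1.
have cS : compact S.
  apply: bounded_closed_compact.
    by exists 1; split=> // M M1 v /= ->; exact: ltW.
  have -> : S = (fun v => `|v|) @^-1` [set 1] by [].
  apply: closed_comp; last exact: closed_eq.
  by move=> v _; exact: norm_continuous.
have [v vS vmin] := @EVT_min_rV R d.+1 f S S0 cS (continuous_subspaceT cf).
move: vS; rewrite inE => vS.
have fv : 0 < f v.
  rewrite lt_def (is_norm_ge0 hN)// andbT.
  apply/negP => /eqP /(is_norm_eq0 hN) v0.
  have : v = 0 by rewrite -(trmxK v) v0 trmx0.
  move=> v00; move: vS; rewrite /S /= v00 normr0 => /eqP.
  by rewrite eq_sym oner_eq0.
exists (f v)^-1; split; first by rewrite invr_ge0 ltW.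
move=> w; rewrite mulrC ler_pdivlMr//.
have [->|w0] := eqVneq w 0; first by rewrite normr0 mul0r is_norm_ge0.
have wT : 0 < `|w^T|.
  rewrite normr_gt0; apply/eqP => h; move/eqP: w0; apply.
  by rewrite -(trmxK w) h trmx0.
have ww : `|w| <= `|w^T|.
  apply: mx_norm_le => // i j.
  by have := mx_entry_le_norm w^T j i; rewrite mxE.
have := vmin (`|w^T|^-1 *: w^T); rewrite inE /S/= normrZ normfV normr_id.
rewrite mulVf ?gt_eqF//.
move=> /(_ erefl) h.
have : f v * `|w^T| <= N w.
  rewrite -ler_pdivlMr// mulrC; apply: le_trans h _.
  by rewrite /f linearZ/= trmxK (is_normZ hN) ger0_norm// invr_ge0.
by apply: le_trans; rewrite mulrC ler_wpM2l// ltW.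
Qed.

(** Turns entrywise bounds into bounds for [N], with a constant independent of the matrix, hence the
    same for all powers of [A]. *)
Lemma mulmx_norm_le (R : realType) (n : nat) (N : 'cV[R]_n.+1 -> R) :
  is_norm N -> exists c, 0 <= c /\ forall (M : 'M[R]_n.+1) (b : R) v,
    0 <= b -> (forall i j, `|M i j| <= b) -> N (M *m v) <= c * b * N v.
Proof.
move=> hN; have [c1 [c10 Nc]] := norm_le_mx_norm hN.
have [c2 [c20 cN]] := mx_norm_le_norm hN.
exists (c1 * n.+1%:R * c2); split; first by rewrite !mulr_ge0.
move=> M b v b0 Mb.
have : `|M *m v| <= n.+1%:R * b * `|v|.
  apply: mx_norm_le; first by rewrite !mulr_ge0.
  move=> i j; rewrite mxE (le_trans (ler_norm_sum _ _ _))//.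
  rewrite -[X in X%:R]card_ord -mulrA mulr_natl -sumr_const.
  by apply: ler_sum => k _; rewrite normrM ler_pM ?mx_entry_le_norm.
move=> h; apply: le_trans (Nc _) _.
have -> : c1 * n.+1%:R * c2 * b * N v = c1 * (n.+1%:R * b * (c2 * N v)) by ring.
apply: ler_wpM2l => //; apply: le_trans h _; apply: ler_wpM2l => //.
by rewrite mulr_ge0.
Qed.

(** * Regularity of histories and boundedness on compact sets *)

Lemma within_shift (R : realType) (A B : set R) (t s : R) :
  (forall u, A u -> B (t + u)) ->
  (t + u) @[u --> within A (nbhs s)] --> within B (nbhs (t + s)).
Proof.
move=> AB P; rewrite /within /= => BP.
have ct : (t + u) @[u --> s] --> t + s.
  by apply: cvgD; [exact: cvg_cst|exact: cvg_id].
by apply: (@filterS _ (nbhs s) _ _ _ _ (ct _ BP)) => u /= h /AB.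
Qed.

Lemma history_in_phase_space (r : regularity) (R : realType) (d : nat) (T t : R)
    (x : R -> 'cV[R]_d) :
  0 <= t -> has_regularity r `[- T, +oo[ x -> in_phase_space r T (history x t).
Proof.
move=> t0; have sub u : - T <= u -> - T <= t + u.
  by move=> h; rewrite (le_trans h)// lerDr.
rewrite /in_phase_space; case: r => /=.
  move=> /subspace_continuousP cx; apply/subspace_continuousP => s sT.
  have st : `[- T, +oo[%classic (t + s).
    by move: sT; rewrite /= !in_itv/= andbT => /andP[+ _]; exact: sub.
  apply: cvg_trans (cx _ st); apply: (cvg_app x (within_shift _)).
  by move=> u; rewrite /= !in_itv/= andbT => /andP[+ _]; exact: sub.
(* One-sided filters are neighbourhood filters restricted to half-lines, so [within_shift] applies
   to them as well. *)
move=> [xr xl]; split=> s; rewrite /= in_itv/= => /andP[Ts s0] [u];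
  rewrite /= in_itv/= => /andP[Tu u0] su.
  have [||l xsl] := xr (t + s); first by rewrite /= in_itv/= andbT sub.
    by exists (t + u); rewrite /= ?in_itv/= ?andbT ?sub// ltrD2l.
  exists l; apply: cvg_trans xsl; apply: (cvg_app x (within_shift _)).
  by move=> v /=; rewrite ltrD2l.
have [||l xsl] := xl (t + s); first by rewrite /= in_itv/= andbT sub.
  by exists (t + u); rewrite /= ?in_itv/= ?andbT ?sub// ltrD2l.
exists l; apply: cvg_trans xsl; apply: (cvg_app x (within_shift _)).
by move=> v /=; rewrite ltrD2l.
Qed.

Lemma locally_bounded_compact (R : realType) (d : nat) (K : set R)
    (f : R -> 'cV[R]_d) :
  compact K -> (forall t, K t -> bounded_near f (within K (nbhs t))) ->
  exists M, forall s, K s -> `|f s| <= M.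
Proof.
move=> /compact_near_coveringP /near_covering_withinP cK bf.
(* Compactness in near-covering form, the parameter being a bound [M] that tends to infinity. *)
have [|M [_ MP]] := cK R (+oo) (fun M s => `|f s| <= M) _ _.
  move=> t Kt; have [M M0 fM] := ex_strict_bound_gt0 (bf t Kt).
  exists ([set s | K s -> `|f s| < M], [set M' | M <= M']); first split=> //=.
    by apply: nbhs_pinfty_ge; exact: num_real.
  by move=> [s M'] /= [fsM MM'] /fsM /ltW /le_trans; exact.
by exists (M + 1) => s Ks; apply: (MP (M + 1)) => //; rewrite ltrDl.
Qed.

Lemma bounded_near_setU (R : realType) (d : nat) (f : R -> 'cV[R]_d) (t : R)
    (A B : set R) :
  bounded_near f (within A (nbhs t)) -> bounded_near f (within B (nbhs t)) ->
  bounded_near f (within (A `|` B) (nbhs t)).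
Proof.
move=> [M [Mr fM]] [M' [M'r fM']]; exists (Num.max M M'); split.
  exact: num_real.
move=> c; rewrite gt_max => /andP[Mc M'c].
have := fM c Mc; have := fM' c M'c; rewrite /within /=.
by apply: filterS2 => s h1 h2 [/h2|/h1].
Qed.

(** In the regulated case, a neighbourhood of [t] in [K] splits into [t] itself and its two sides.
    On each side either the one-sided limit bounds [f] or there is no point of [K]. *)
Lemma has_regularity_bounded (r : regularity) (R : realType) (d : nat)
    (K : set R) (f : R -> 'cV[R]_d) :
  compact K -> has_regularity r K f -> exists M, forall s, K s -> `|f s| <= M.
Proof.
move=> cK fr; apply: locally_bounded_compact => // t Kt; case: r fr => /=.
  by move=> /subspace_continuousP /(_ _ Kt); exact: cvg_bounded.
move=> [fr fl].
have bt : bounded_near f (within [set t] (nbhs t)).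
  exists `|f t|; split; first exact: num_real.
  by move=> M tM; rewrite /within /=; near=> s => ->; exact: ltW.
have br : bounded_near f (within (K `&` [set s | t < s]) (nbhs t)).
  have [tu|tu] := pselect (exists2 u, K u & t < u).
    have [l /cvg_bounded] := fr t Kt tu; apply: sub_boundedr => P.
    by rewrite /at_right /within /=; apply: filterS => s h [_ /h].
  exists 0; split; first exact: num_real.
  move=> M _; rewrite /within /=; near=> s => -[Ks ts]; exfalso; apply: tu.
  by exists s.
have bl : bounded_near f (within (K `&` [set s | s < t]) (nbhs t)).
  have [tu|tu] := pselect (exists2 u, K u & u < t).
    have [l /cvg_bounded] := fl t Kt tu; apply: sub_boundedr => P.
    by rewrite /at_left /within /=; apply: filterS => s h [_ /h].
  exists 0; split; first exact: num_real.
  move=> M _; rewrite /within /=; near=> s => -[Ks ts]; exfalso; apply: tu.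
  by exists s.
have := bounded_near_setU (bounded_near_setU bt br) bl.
apply: sub_boundedr => P; rewrite /within /=.
apply: filterS => s h Ks; apply: h.
by have [st|ts|->] := ltgtP s t; [right|left; right|left; left].
Unshelve. all: by end_near. Qed.

(** * Backtracking along the delays and exponential decay *)

Lemma delay_equation_backtrack (R : realType) (n : nat) (A : 'M[R]_n.+1)
    (m T : R) (delta : R -> R) (x : R -> 'cV[R]_n.+1) :
  0 < m ->
  (forall t, 0 <= t -> m <= delta t <= T /\ x t = A *m x (t - delta t)) ->
  forall t, 0 <= t ->
  exists k s, [/\ - T <= s <= 0, t <= k%:R * T & x t = A ^+ k *m x s].
Proof.
move=> m0 xA t; have [j] : exists j : nat, t < j%:R * m.
  by exists (Num.truncn (t / m)).+1; rewrite -ltr_pdivrMr// truncnS_gt.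
(* Each step back lowers the time by at least [m], hence the induction on [j] with [t < j * m]; it
   lowers it by at most [T], hence [t <= k * T]. *)
elim: j t => [|j ih] t tj t0; first by move: tj; rewrite mul0r ltNge t0.
have [/andP[md dT] xt] := xA t t0; have [dt|td] := leP (delta t) t.
  have [||k [s [sT tk xs]]] := ih (t - delta t); rewrite ?subr_ge0//.
    by move: tj; rewrite -natr1; lra.
  exists k.+1, s; split=> //; first by rewrite -natr1; lra.
  by rewrite xt xs mulmxA mulmxE -exprS.
exists 1%N, (t - delta t); split; last by rewrite expr1.
  by apply/andP; split; lra.
by rewrite mul1r; lra.
Qed.

Theorem theorem6p1 (r : regularity) (R : realType) (d : nat) (hd : (0 < d)%N)
    (N : 'cV[R]_d -> R) (hN : is_norm N)
    (A : 'M[R]_d)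
    (I : set R) (I_nonempty : I !=set0) (I_interval : is_interval I)
    (I_compact : compact I) (I_pos : I `<=` [set u : R | 0 < u])
    (tau : R -> (R -> 'cV[R]_d) -> R) (htau : is_delay r (sup I) I tau) :
  spectral_radius A < 1 ->
  exists C gamma : R, [/\ 0 < C, 0 < gamma &
    forall x : R -> 'cV[R]_d, is_solution r (sup I) A tau x ->
      forall t : R, 0 <= t ->
        phase_norm N (sup I) (history x t)
          <= C * expR (- (gamma * t)) * phase_norm N (sup I) (history x 0)].
Proof.
move=> rA; case: d hd N hN A tau htau rA => // n _ N hN A tau [tauI _] rA.
have [m Im mI] : exists2 m, I m & forall u, I u -> m <= u.
  have [m] := @compact_EVT_min R R id I I_nonempty I_compact
    (continuous_subspaceT (fun _ => cvg_id)).
  by rewrite inE => Im mI; exists m => // u Iu; apply: mI; rewrite inE.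
have m0 : 0 < m := I_pos _ Im.
have IT u : I u -> u <= sup I.
  by apply: ub_le_sup; case: (compact_has_sup I_nonempty I_compact).
set T := sup I in tauI IT *.
have T0 : 0 < T := lt_le_trans m0 (IT _ Im).
have [q [C [/andP[q0 q1] C0 Aq]]] := spectral_radius_power_bound rA.
have [c [c0 Nc]] := mulmx_norm_le hN.
(* As q = exp(-g), having [u <= k * T] gives q^k <= exp(-(g / T) u), so the rate is [g / T]. *)
pose g := - ln q; have g0 : 0 < g by rewrite oppr_gt0 ln_lt0// q0.
have gT : 0 < g / T by rewrite divr_gt0.
have cC : 0 <= c * C by rewrite mulr_ge0.
(* The exponential factor pays for the history at t reaching back to t - T. The added 1 makes the
   constant positive and covers negative times. *)
exists ((c * C + 1) * expR (g / T * T)), (g / T); split=> //.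
  by rewrite mulr_gt0 ?expR_gt0// ltr_wpDl.
move=> x [xr xA]; set P := phase_norm N T (history x 0).
have xP s : - T <= s <= 0 -> N (x s) <= P.
  move=> sT; apply: ub_le_sup; last first.
    by exists s; rewrite /= ?in_itv//= /history add0r.
  have [c1 [c10 Nc1]] := norm_le_mx_norm hN.
  have [M xM] := has_regularity_bounded (@segment_compact R (- T) 0)
    (history_in_phase_space (lexx 0) xr).
  exists (c1 * M) => _ [u uT <-]; apply: le_trans (Nc1 _) _.
  by apply: ler_wpM2l => //; exact: xM.
have P0 : 0 <= P.
  by apply: le_trans (xP 0 _); [exact: is_norm_ge0|rewrite lexx oppr_le0 ltW].
(* Along a fixed solution the state-dependent delay is a function of time alone. *)
have xdelta t : 0 <= t -> m <= tau t (history x t) <= T /\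
    x t = A *m x (t - tau t (history x t)).
  move=> t0; have It := tauI t _ t0 (history_in_phase_space t0 xr).
  by split; [rewrite mI ?IT|exact: xA].
(* Negative [u] are included because the history at a time t < T overlaps the initial interval;
   there the exponential is at least 1. *)
have decay u : - T <= u -> N (x u) <= (c * C + 1) * expR (- (g / T * u)) * P.
  move=> uT; have [u0|u0] := leP 0 u; last first.
    apply: le_trans (xP u _) _; first by rewrite uT ltW.
    rewrite -{1}(mul1r P) ler_wpM2r// mulr_ege1 ?lerDr//.
    by rewrite -expR0 ler_expR oppr_ge0 nmulr_lle0// ltW.
  have [k [s [sT uk ->]]] := delay_equation_backtrack m0 xdelta u0.
  have qk : q ^+ k <= expR (- (g / T * u)).
    have -> : q ^+ k = expR (- (g * k%:R)).
      by rewrite /g mulNr opprK mulrC expRM_natl lnK.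
    by rewrite ler_expR lerN2 mulrAC ler_pdivrMr// -mulrA ler_pM2l.
  have qk0 : 0 <= q ^+ k by rewrite exprn_ge0// ltW.
  apply: le_trans (Nc (A ^+ k) (C * q ^+ k) (x s) _ (Aq k)) _.
    exact: mulr_ge0.
  apply: ler_pM; rewrite ?mulr_ge0 ?(is_norm_ge0 hN) ?xP//.
  rewrite mulrA; apply: ler_pM => //; first by rewrite lerDl.
move=> t t0; apply: ge_sup.
  by exists (N (history x t 0)), 0; rewrite //= in_itv/= lexx oppr_le0 ltW.
move=> _ [s sT <-]; move: sT; rewrite /= in_itv/= /history => /andP[Ts s0].
apply: le_trans (decay _ _) _; first by lra.
apply: ler_wpM2r => //; rewrite -[leRHS]mulrA -expRD; apply: ler_wpM2l.
  by rewrite addr_ge0.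
rewrite ler_expR; nra.
Qed.
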